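(* Let $\mu\in\mathbb{C}$ with $|\mu|\leq 1$ and let $\Phi(z)=\mu z$ for $z\in\mathbb{C}$. Then the composition operator $C_\Phi$ is an isometry on $H_E(\xi)$ if and only if $|\mu|=1$.
   Context: Let $\xi=(\xi_n)_{n\ge 0}$ be a sequence of positive real numbers with $\lim_{n\to\infty}\xi_n^{1/n}=\infty$. $H_E(\xi)$ is the Hilbert space of entire functions $f(z)=\sum_{n=0}^\infty a_n z^n$ with $\|f\|^2=\sum_{n=0}^\infty |a_n|^2\xi_n^2<\infty$, with inner product $\langle f,g\rangle=\sum_{n=0}^\infty b_n\overline{c_n}\,\xi_n^2$ for $f=\sum b_nz^n$, $g=\sum c_nz^n$. For an entire function $\Phi$, the composition operator is $C_\Phi f=f\circ\Phi$; for $\Phi(z)=\mu z$ with $|\mu|\le 1$ it is bounded on $H_E(\xi)$. A bounded linear operator $S$ on a Hilbert space $H$ is an isometry if $\|Sx\|=\|x\|$ for all $x\in H$ (equivalently $S^*S=I$). *)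

(* Defs.v *)
From Stdlib Require Import Reals Lra Lia ClassicalEpsilon.
From Coquelicot Require Import Coquelicot.
Open Scope R_scope.

Definition entire (f : C -> C) : Prop :=
  forall z : C, ex_derive (K := C_AbsRing) (V := C_NormedModule) f z.

Definition is_expansion (a : nat -> C) (f : C -> C) : Prop :=
  forall z : C, is_pseries (K := C_AbsRing) (V := C_NormedModule) a z (f z).

(* The sequence expanding [f]; unspecified when [f] has no expansion, and
   unique when it has one (see [coef_unique]). *)
Definition coef (f : C -> C) : nat -> C :=
  epsilon (inhabits (fun _ => RtoC 0)) (fun a => is_expansion a f).

Definition H_E (xi : nat -> R) (f : C -> C) : Prop :=
  entire f /\
  exists a : nat -> C,
    is_expansion a f /\ ex_series (fun n => Cmod (a n) ^ 2 * xi n ^ 2).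

Definition H_E_norm (xi : nat -> R) (f : C -> C) : R :=
  sqrt (Series (fun n => Cmod (coef f n) ^ 2 * xi n ^ 2)).

Definition comp_op (Phi : C -> C) (f : C -> C) : C -> C := fun z => f (Phi z).

(* A space of functions is given by its membership predicate [H] and its
   norm [N]; operators act on all functions and only their restriction to
   [H] matters. *)
Record is_bounded_operator (H : (C -> C) -> Prop) (N : (C -> C) -> R)
    (S : (C -> C) -> (C -> C)) : Prop := {
  operator_maps : forall f, H f -> H (S f);
  operator_linear : forall (c : C) f g, H f -> H g ->
    forall z, S (fun w => c * f w + g w)%C z = (c * S f z + S g z)%C;
  operator_bounded : exists M : R, forall f, H f -> N (S f) <= M * N f
}.

Definition is_isometry (H : (C -> C) -> Prop) (N : (C -> C) -> R)
    (S : (C -> C) -> (C -> C)) : Prop :=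
  is_bounded_operator H N S /\ forall f, H f -> N (S f) = N f.

Lemma vanishing_pseries_0 (e : nat -> C) :
  (forall z : C, z <> RtoC 0 ->
     is_pseries (K := C_AbsRing) (V := C_NormedModule) e z (RtoC 0)) ->
  e 0%nat = RtoC 0.
Proof.
intros He.
assert (H1 : is_pseries (K := C_AbsRing) (V := C_NormedModule) e (RtoC 1) (RtoC 0)).
{ apply He. intros E. apply (f_equal fst) in E. simpl in E. lra. }
destruct (filterlim_bounded (K := C_AbsRing) (V := C_NormedModule) _
            (ex_intro _ _ H1)) as [M HM].
assert (Hp : forall n, pow_n (K := C_Ring) (RtoC 1) n = RtoC 1).
{ induction n as [|n IH]; [reflexivity|]. simpl. rewrite IH.
  change (RtoC 1 * RtoC 1 = RtoC 1)%C. ring. }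
assert (Hb : forall n, Cmod (e n) <= 2 * M).
{ intros n.
  assert (HM' : forall n, Cmod (sum_n (G := C_AbelianMonoid) e n) <= M).
  { intros k. specialize (HM k).
    change (Cmod (sum_n (G := C_AbelianMonoid)
      (fun j => pow_n (K := C_Ring) (RtoC 1) j * e j)%C k) <= M) in HM.
    rewrite (sum_n_ext _ e) in HM; [exact HM|].
    intros j. rewrite Hp. exact (Cmult_1_l (e j)). }
  destruct n as [|n].
  - pose proof (HM' 0%nat) as A. rewrite sum_O in A.
    pose proof (Cmod_ge_0 (e 0%nat)). lra.
  - pose proof (HM' (S n)) as A. pose proof (HM' n) as B.
    rewrite sum_Sn in A.
    set (s := sum_n _ n) in *. change (Cmod (s + e (S n))%C <= M) in A.
    replace (e (S n)) with ((s + e (S n)) + - s)%C by ring.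
    eapply Rle_trans; [apply Cmod_triangle|]. rewrite Cmod_opp. lra. }
assert (M0 : 0 <= M) by (pose proof (Hb 0%nat); pose proof (Cmod_ge_0 (e 0%nat)); lra).
assert (Ht : forall t, 0 < t <= / 2 -> Cmod (e 0%nat) <= 4 * M * t).
{ intros t Ht.
  assert (Hz : RtoC t <> RtoC 0).
  { intros E. apply (f_equal fst) in E. simpl in E. lra. }
  pose proof (He _ Hz) as H.
  apply (is_pseries_decr_1 _ _ (/ RtoC t)%C) in H.
  2:{ change (/ RtoC t * RtoC t = RtoC 1)%C. field. exact Hz. }
  assert (L : Cmod (/ RtoC t * (RtoC 0 + - e 0%nat))%C <= 4 * M).
  { assert (Hn := filterlim_comp _ _ _ _ _ _ _ _ H
      (filterlim_norm (K := C_AbsRing) (V := C_NormedModule) _)).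
    change (norm (V := C_NormedModule) (/ RtoC t * (RtoC 0 + - e 0%nat))%C
            <= 4 * M).
    refine (is_lim_seq_le _ _ (Finite _) (Finite (4 * M)) _ Hn
              (is_lim_seq_const _)).
    intros n. simpl.
    eapply Rle_trans; [apply norm_sum_n_m|].
    eapply Rle_trans.
    { apply (sum_n_m_le _ (fun k => (2 * M) * (/ 2) ^ k)). intros k.
      change (Cmod (pow_n (K := C_Ring) (RtoC t) k * e (S k))%C
              <= 2 * M * (/ 2) ^ k).
      rewrite Cmod_mult, Rmult_comm.
      apply Rmult_le_compat; try apply Cmod_ge_0; [apply Hb|].
      eapply Rle_trans; [exact (abs_pow_n (K := C_AbsRing) (RtoC t) k)|].
      apply pow_incr. change (0 <= Cmod (RtoC t) <= / 2).
      rewrite Cmod_R, Rabs_pos_eq; lra. }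
    change (sum_n (fun k => 2 * M * (/ 2) ^ k) n <= 4 * M).
    rewrite (sum_n_mult_l (K := R_Ring) (2 * M) (fun k => (/ 2) ^ k)).
    rewrite sum_n_Reals. change (2 * M * sum_f_R0 (fun k => (/ 2) ^ k) n <= 4 * M).
    assert (sum_f_R0 (fun k => (/ 2) ^ k) n <= 2).
    { rewrite tech3 by lra.
      assert (0 < (/ 2) ^ S n) by (apply pow_lt; lra). lra. }
    nra. }
  rewrite Cmod_mult, Cmod_inv, Cmod_R, Rabs_pos_eq in L by (auto; lra).
  replace (RtoC 0 + - e 0%nat)%C with (- e 0%nat)%C in L by ring.
  rewrite Cmod_opp in L.
  apply (Rmult_le_compat_l t) in L; [|lra].
  rewrite <- Rmult_assoc, Rinv_r, Rmult_1_l in L by lra. lra. }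
apply Cmod_eq_0. apply Rle_antisym; [|apply Cmod_ge_0].
apply Rnot_lt_le. intros P. set (x := Cmod (e 0%nat)) in *.
pose proof (Ht (/ 2) ltac:(lra)) as B.
assert (Mp : 0 < M) by lra.
assert (T : 0 < x / (8 * M) <= / 2).
{ split; [apply Rdiv_lt_0_compat; lra|].
  apply (Rmult_le_reg_r (8 * M)); [lra|]. field_simplify; lra. }
pose proof (Ht _ T) as D. replace (4 * M * (x / (8 * M))) with (x / 2) in D by (field; lra).
lra.
Qed.

Lemma expansion_unique (a b : nat -> C) (f : C -> C) :
  is_expansion a f -> is_expansion b f -> forall n, a n = b n.
Proof.
intros Ha Hb.
assert (K : forall n (e : nat -> C),
  (forall z : C, z <> RtoC 0 ->
     is_pseries (K := C_AbsRing) (V := C_NormedModule) e z (RtoC 0)) ->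
  e n = RtoC 0).
{ induction n as [|n IH]; intros e He.
  - now apply vanishing_pseries_0.
  - apply (IH (fun k => e (S k))). intros z Hz.
    pose proof (is_pseries_decr_1 _ z (/ z)%C _
      ltac:(change (/ z * z = RtoC 1)%C; field; exact Hz) (He z Hz)) as H.
    rewrite (vanishing_pseries_0 e He) in H.
    replace (RtoC 0) with (/ z * (RtoC 0 + - RtoC 0))%C by ring.
    exact H. }
intros n.
assert (D : (a n + - b n)%C = RtoC 0).
{ apply (K n (fun k => a k + - b k)%C). intros z _.
  replace (RtoC 0) with (f z + - f z)%C by ring.
  exact (is_pseries_minus _ _ _ _ _ (Ha z) (Hb z)). }
replace (a n) with ((a n + - b n) + b n)%C by ring. rewrite D. ring.
Qed.

Lemma coef_unique (a : nat -> C) (f : C -> C) :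
  is_expansion a f -> forall n, coef f n = a n.
Proof.
intros Ha. apply (expansion_unique _ _ f); [|exact Ha].
unfold coef.
apply (epsilon_spec (inhabits _) (fun b => is_expansion b f)). now exists a.
Qed.

(* Main.v *)
(** [C_Phi] multiplies the [n]-th Taylor coefficient by [mu ^ n], which preserves
    its modulus when [|mu| = 1]; conversely, testing on [f z = z] gives
    [|mu| * xi 1 = xi 1]. *)

Require Import Defs.
From Stdlib Require Import Reals Lra.
From Coquelicot Require Import Coquelicot.
Open Scope R_scope.

(** If f(z) is the sum of a_n z^n, then f(mu z) is the sum of mu^n a_n z^n. For |mu| = 1 each term
    |a_n|^2 xi_n^2 is unchanged, which gives both stability of the space ([H_E_dilation]) and
    equality of norms ([H_E_norm_dilation]). Conversely, an isometry preserves the norm of the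
    function z, whose image is mu z; by [H_E_norm_monomial_1] and [H_E_norm_id] this reads |mu| xi_1
    = xi_1, and xi_1 > 0 cancels. *)

Lemma entire_id : entire (fun z => z).
Proof.
intros z.
apply (ex_derive_ext (K := C_AbsRing) (V := C_NormedModule)
         (fun w : C => scal w (RtoC 1))).
- intros w. exact (Cmult_1_r w).
- apply (ex_derive_scal_l (K := C_AbsRing) (V := C_NormedModule)).
  apply ex_derive_id.
Qed.

Lemma entire_dilation (mu : C) (f : C -> C) :
  entire f -> entire (comp_op (fun z => mu * z)%C f).
Proof.
intros Hf z.
apply (ex_derive_comp (K := C_AbsRing) (V := C_NormedModule)
         f (fun w : C => (mu * w)%C)).
- apply Hf.
(* The constant goes to the right because [ex_derive_scal_l] differentiates a scalar function times
   a fixed vector. *)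
- apply (ex_derive_ext (K := C_AbsRing) (fun w : C_AbsRing => mult w mu)).
  + intros w. exact (Cmult_comm w mu).
  + apply (ex_derive_scal_l (K := C_AbsRing)
             (V := AbsRing_NormedModule C_AbsRing) (fun w => w) z mu).
    apply ex_derive_id.
Qed.

(** Since (mu z)^n = z^n mu^n, the series at z is termwise the series of f at mu z. *)
Lemma is_expansion_dilation (mu : C) (a : nat -> C) (f : C -> C) :
  is_expansion a f ->
  is_expansion (fun n => pow_n (K := C_Ring) mu n * a n)%C
    (comp_op (fun z => mu * z)%C f).
Proof.
intros Ha z. refine (is_series_ext _ _ _ _ (Ha (mu * z)%C)).
intros n.
change (pow_n (K := C_Ring) (mu * z)%C n * a n
        = pow_n (K := C_Ring) z n * (pow_n (K := C_Ring) mu n * a n))%C.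
assert (Hp : pow_n (K := C_Ring) (mu * z)%C n
             = (pow_n (K := C_Ring) z n * pow_n (K := C_Ring) mu n)%C).
{ induction n as [|n IH]; simpl.
  - symmetry. exact (Cmult_1_l _).
  - rewrite IH.
    change (mu * z * (pow_n (K := C_Ring) z n * pow_n (K := C_Ring) mu n)
      = z * pow_n (K := C_Ring) z n * (mu * pow_n (K := C_Ring) mu n))%C. ring. }
rewrite Hp. ring.
Qed.

(** The norm is defined through the epsilon-chosen [coef]; uniqueness of power series coefficients
    lets any known expansion compute it. *)
Lemma H_E_norm_expansion (xi : nat -> R) (a : nat -> C) (f : C -> C) :
  is_expansion a f ->
  H_E_norm xi f = sqrt (Series (fun n => Cmod (a n) ^ 2 * xi n ^ 2)).
Proof.
intros Ha. unfold H_E_norm. f_equal. apply Series_ext. intros n.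
now rewrite (coef_unique a f Ha).
Qed.

Lemma Cmod_pow_n_unit (mu : C) (n : nat) :
  Cmod mu = 1 -> Cmod (pow_n (K := C_Ring) mu n) = 1.
Proof.
intros Hmu. induction n as [|n IH]; simpl.
- exact Cmod_1.
- change (Cmod (mu * pow_n (K := C_Ring) mu n)%C = 1).
  rewrite Cmod_mult, Hmu, IH. lra.
Qed.

(** A general c covers both the test function z and its image mu z. *)
Definition monomial_1_coef (c : C) (n : nat) : C :=
  match n with 1%nat => c | _ => RtoC 0 end.

(** The partial sums are constant from index 1 on. The generality in [V] serves both the complex
    power series and the real series of the norm. *)
Lemma is_series_single_1 (K : AbsRing) (V : NormedModule K) (u : nat -> V) :
  (forall n, n <> 1%nat -> u n = zero) -> is_series u (u 1%nat).
Proof.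
intros Hu.
apply (filterlim_ext_loc (fun _ => u 1%nat)).
- exists 1%nat. intros n Hn. induction Hn as [|n Hn IH].
  + rewrite sum_Sn, sum_O, (Hu 0%nat), plus_zero_l; auto.
  + rewrite sum_Sn, <- IH, (Hu (S n)), plus_zero_r; auto.
    intros E. injection E as E. rewrite E in Hn. inversion Hn.
- apply filterlim_const.
Qed.

Lemma is_expansion_monomial_1 (c : C) :
  is_expansion (monomial_1_coef c) (fun z => c * z)%C.
Proof.
intros z.
pose proof (is_series_single_1 C_AbsRing C_NormedModule
  (fun n => scal (pow_n (K := C_AbsRing) z n) (monomial_1_coef c n))) as H.
assert (E : scal (pow_n (K := C_AbsRing) z 1) (monomial_1_coef c 1) = (c * z)%C).
{ change (z * RtoC 1 * c = c * z)%C. ring. }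
rewrite <- E. apply H.
intros [|[|n]] Hn; [|now elim Hn|]; exact (Cmult_0_r _).
Qed.

Lemma is_series_monomial_1 (xi : nat -> R) (c : C) :
  is_series (fun n => Cmod (monomial_1_coef c n) ^ 2 * xi n ^ 2)
    (Cmod c ^ 2 * xi 1%nat ^ 2).
Proof.
apply (is_series_single_1 R_AbsRing R_NormedModule
  (fun n => Cmod (monomial_1_coef c n) ^ 2 * xi n ^ 2)).
intros [|[|n]] Hn; [|now elim Hn|]; simpl; rewrite Cmod_0;
  unfold zero; simpl; ring.
Qed.

Lemma H_E_norm_monomial_1 (xi : nat -> R) (c : C) :
  0 < xi 1%nat -> H_E_norm xi (fun z => c * z)%C = Cmod c * xi 1%nat.
Proof.
intros Hxi. rewrite (H_E_norm_expansion _ _ _ (is_expansion_monomial_1 c)).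
rewrite (is_series_unique _ _ (is_series_monomial_1 xi c)).
rewrite <- Rpow_mult_distr. apply sqrt_pow2.
apply Rmult_le_pos; [apply Cmod_ge_0 | lra].
Qed.

Lemma is_expansion_id : is_expansion (monomial_1_coef (RtoC 1)) (fun z => z).
Proof.
intros z. pose proof (is_expansion_monomial_1 (RtoC 1) z) as H.
now rewrite Cmult_1_l in H.
Qed.

Lemma H_E_id (xi : nat -> R) : H_E xi (fun z => z).
Proof.
split; [exact entire_id|].
exists (monomial_1_coef (RtoC 1)). split; [exact is_expansion_id|].
eexists. apply is_series_monomial_1.
Qed.

Lemma H_E_norm_id (xi : nat -> R) :
  0 < xi 1%nat -> H_E_norm xi (fun z => z) = xi 1%nat.
Proof.
intros Hxi.
rewrite (H_E_norm_expansion _ _ _ is_expansion_id).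
(* The functions z and 1 * z share their coefficients, so their norms agree without identifying the
   two functions. *)
rewrite <- (H_E_norm_expansion _ _ _ (is_expansion_monomial_1 (RtoC 1))).
rewrite H_E_norm_monomial_1, Cmod_1 by exact Hxi. ring.
Qed.

Lemma Cmod_dilation_coef (mu : C) (xi : nat -> R) (a : nat -> C) (n : nat) :
  Cmod mu = 1 ->
  Cmod (pow_n (K := C_Ring) mu n * a n)%C ^ 2 * xi n ^ 2
  = Cmod (a n) ^ 2 * xi n ^ 2.
Proof.
intros Hmu. now rewrite Cmod_mult, Cmod_pow_n_unit, Rmult_1_l.
Qed.

Lemma H_E_dilation (mu : C) (xi : nat -> R) (f : C -> C) :
  Cmod mu = 1 -> H_E xi f -> H_E xi (comp_op (fun z => mu * z)%C f).
Proof.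
intros Hmu [Hf [a [Ha Hs]]]. split; [now apply entire_dilation|].
exists (fun n => pow_n (K := C_Ring) mu n * a n)%C.
split; [now apply is_expansion_dilation|].
refine (ex_series_ext _ _ _ Hs). intros n. symmetry.
now apply Cmod_dilation_coef.
Qed.

Lemma H_E_norm_dilation (mu : C) (xi : nat -> R) (f : C -> C) :
  Cmod mu = 1 -> H_E xi f ->
  H_E_norm xi (comp_op (fun z => mu * z)%C f) = H_E_norm xi f.
Proof.
intros Hmu [_ [a [Ha _]]].
rewrite (H_E_norm_expansion _ _ _ (is_expansion_dilation mu a f Ha)).
rewrite (H_E_norm_expansion _ _ _ Ha).
f_equal. apply Series_ext. intros n. now apply Cmod_dilation_coef.
Qed.

Theorem theorem2p2 (xi : nat -> R)
  (xi_pos : forall n : nat, 0 < xi n)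
  (xi_lim : is_lim_seq (fun n : nat => Rpower (xi n) (/ INR n)) p_infty)
  (mu : C) (hmu : Cmod mu <= 1) :
  is_isometry (H_E xi) (H_E_norm xi) (comp_op (fun z : C => (mu * z)%C))
  <-> Cmod mu = 1.
Proof.
split.
- intros [_ H].
  specialize (H (fun z => z) (H_E_id xi)).
  change (H_E_norm xi (fun z => mu * z)%C = H_E_norm xi (fun z => z)) in H.
  rewrite H_E_norm_monomial_1, H_E_norm_id in H by apply xi_pos.
  pose proof (xi_pos 1%nat).
  apply (Rmult_eq_reg_r (xi 1%nat)); lra.
- intros Hmu. split; [split|].
  + intros f Hf. now apply H_E_dilation.
  (* Composition acts pointwise, so both sides of the linearity equation unfold to the same term. *)
  + reflexivity.
  + exists 1. intros f Hf. rewrite H_E_norm_dilation by assumption. lra.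
  + intros f Hf. now apply H_E_norm_dilation.
Qed.
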